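(* Let $L\ge 1$ be an integer. A set $\mathcal{K}\subset\{0,\ldots,L-1\}$ defines a universal covariance sampler if and only if $\Delta(\mathcal{K})=\{0,\ldots,L-1\}$.
   Context: The difference set of $\mathcal{A}\subset\mathbb{Z}$ is $\Delta(\mathcal{A})=\{\delta\ge 0:\ \exists a_1,a_2\in\mathcal{A}\text{ such that }\delta=a_2-a_1\}$. Covariance samplers: given a linearly independent set (over $\mathbb{R}$) $\mathcal{S}$ of $L\times L$ Hermitian Toeplitz matrices, a matrix $\bar\Phi\in\mathbb{C}^{K\times L}$ defines an $\mathcal{S}$-covariance sampler if the map $\phi:\mathrm{span}_{\mathbb{R}}\,\mathcal{S}\to\mathrm{span}_{\mathbb{R}}\{\bar\Phi\Sigma_s\bar\Phi^H:\Sigma_s\in\mathcal{S}\}$, $\phi(\Sigma)=\bar\Phi\Sigma\bar\Phi^H$, is invertible. The matrix $\bar\Phi$ defines a universal covariance sampler if it defines an $\mathcal{S}$-covariance sampler for every linearly independent set $\mathcal{S}$ of $L\times L$ Hermitian Toeplitz matrices. A set $\mathcal{K}\subset\{0,\ldots,L-1\}$ is said to define a universal covariance sampler if the (sparse) matrix $\bar\Phi\in\mathbb{C}^{|\mathcal{K}|\times L}$ formed by the rows of the identity matrix $I_L$ with indices in $\mathcal{K}$ (in increasing order; rows indexed from $0$) does. *)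

(* Defs.v *)
(* MathComp and MathComp-Analysis; complex numbers are R[i] over R : realType. *)
From HB Require Import structures.
From mathcomp Require Import all_boot all_order all_algebra.
From mathcomp Require Import sesquilinear spectral.
From mathcomp Require Import boolp classical_sets functions reals.
From mathcomp Require Import complex.

Set Implicit Arguments.
Unset Strict Implicit.
Unset Printing Implicit Defensive.

Import Order.TTheory GRing.Theory Num.Theory.
Local Open Scope classical_set_scope.
Local Open Scope ring_scope.
Local Open Scope complex_scope.
Local Open Scope sesquilinear_scope.

Definition difference_set (A : set int) : set int :=
  [set d : int | 0 <= d /\
     exists a1 : int, exists a2 : int, [/\ A a1, A a2 & d = a2 - a1]].

(* The cross-multiplied condition i + j' = i' + j says i - j = i' - j'
   without truncated subtraction. *)
Definition toeplitz (T : Type) (m n : nat) (M : 'M[T]_(m, n)) : Prop :=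
  forall (i i' : 'I_m) (j j' : 'I_n),
    (i + j' = i' + j)%N -> M i j = M i' j'.

(* Complex matrices are regarded as a vector space over R: the scalars range
   over R and act through the embedding c |-> c%:C. *)
Definition real_span (R : realType) (m n : nat) (S : set 'M[R[i]]_(m, n)) :
    set 'M[R[i]]_(m, n) :=
  [set M : 'M[R[i]]_(m, n) |
     exists k : nat, exists A : 'I_k -> 'M[R[i]]_(m, n), exists c : 'I_k -> R,
       (forall t, S (A t)) /\ M = \sum_(t < k) (c t)%:C *: A t].

(* S is an arbitrary set, so independence is that of its finite subsets,
   enumerated without repetition. *)
Definition real_lin_indep (R : realType) (m n : nat)
    (S : set 'M[R[i]]_(m, n)) : Prop :=
  forall (k : nat) (A : 'I_k -> 'M[R[i]]_(m, n)) (c : 'I_k -> R),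
    injective A -> (forall t, S (A t)) ->
    \sum_(t < k) (c t)%:C *: A t = 0 -> forall t, c t = 0.

Definition compress (R : realType) (K L : nat) (Phi : 'M[R[i]]_(K, L))
    (Sigma : 'M[R[i]]_L) : 'M[R[i]]_K :=
  Phi *m Sigma *m Phi ^t*.

Definition covariance_sampler (R : realType) (K L : nat)
    (S : set 'M[R[i]]_L) (Phi : 'M[R[i]]_(K, L)) : Prop :=
  set_bij (real_span S) (real_span (compress Phi @` S)) (compress Phi).

Definition universal_covariance_sampler (R : realType) (K L : nat)
    (Phi : 'M[R[i]]_(K, L)) : Prop :=
  forall S : set 'M[R[i]]_L,
    (forall Sigma, S Sigma -> Sigma \is hermsymmx /\ toeplitz Sigma) ->
    real_lin_indep S ->
    covariance_sampler S Phi.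

(* enum_val lists the elements of K : {set 'I_L} in increasing order. *)
Definition sparse_sampler (R : realType) (L : nat) (K : {set 'I_L}) :
    'M[R[i]]_(#|K|, L) :=
  rowsub (fun t : 'I_#|K| => enum_val t) 1%:M.

Definition int_set_of (L : nat) (K : {set 'I_L}) : set int :=
  [set (k%:Z : int) | k in [set k : 'I_L | k \in K]].

(* Main.v *)
(* Compressing by a sparse sampler keeps the entries Sigma k k' with k, k' in K,
   and a Hermitian Toeplitz matrix is determined by its entries Sigma j i with
   j - i = d, one for each d in {0, ..., L-1}. If all these lags are realised in
   K, compression is injective. If a lag d is missing, the 0/1 matrix supported
   on |i - j| = d is a nonzero Hermitian Toeplitz matrix compressed to 0. *)
Require Import Defs.
From mathcomp Require Import all_boot all_order all_algebra.
From mathcomp Require Import sesquilinear spectral zify.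
From mathcomp Require Import boolp classical_sets functions reals.
From mathcomp Require Import complex.

Set Implicit Arguments.
Unset Strict Implicit.
Unset Printing Implicit Defensive.

Import Order.TTheory GRing.Theory Num.Theory.
Local Open Scope classical_set_scope.
Local Open Scope ring_scope.
Local Open Scope complex_scope.
Local Open Scope sesquilinear_scope.

Lemma difference_set_int_set_of (L : nat) (K : {set 'I_L}) (d : nat) :
  difference_set (int_set_of K) d%:Z <->
  exists i j : 'I_L, [/\ i \in K, j \in K & j = (i + d)%N :> nat].
Proof.
split=> [[_ [_ [_ [[i iK <-] [j jK <-] dE]]]]|[i [j [iK jK jE]]]].
  by exists i, j; split=> //; lia.
split=> //; exists i%:Z, j%:Z; split; [by exists i | by exists j | lia].
Qed.

Lemma difference_set_int_set_of_sub (L : nat) (K : {set 'I_L}) :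
  difference_set (int_set_of K) `<=` [set d : int | 0 <= d /\ d < L%:Z].
Proof.
move=> d [d0 [_ [_ [[i _ <-] [j _ <-] dE]]]]; split=> //.
by have := ltn_ord j; lia.
Qed.

Section Span.
Variable R : realType.

Lemma sub_real_span (m n : nat) (S : set 'M[R[i]]_(m, n)) : S `<=` real_span S.
Proof.
move=> M SM; exists 1%N, (fun=> M), (fun=> 1); split=> //.
by rewrite big_ord1 scale1r.
Qed.

Lemma real_span0 (m n : nat) (S : set 'M[R[i]]_(m, n)) : real_span S 0.
Proof.
exists 0%N, (fun=> 0), (fun=> 0); split; last by rewrite big_ord0.
by case.
Qed.

(** An injective family with values in a singleton has at most one index, so the vanishing sum is a
    single term [c t * M]. *)
Lemma real_lin_indep1 (m n : nat) (M : 'M[R[i]]_(m, n)) :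
  M != 0 -> real_lin_indep [set M].
Proof.
move=> M0 k A c injA AM sum0 t.
have tE u : u = t by apply: injA; rewrite (AM u) (AM t).
move: sum0; rewrite (bigD1 t) //= big1 => [|u]; last by rewrite (tE u) eqxx.
move/eqP; rewrite addr0 (AM t) scaler_eq0 (negPf M0) orbF.
by move/eqP; apply: (@complexI R _ 0).
Qed.

Lemma hermsymmx_entry (n : nat) (M : 'M[R[i]]_n) :
  M \is hermsymmx <-> forall i j, M i j = (M j i)^*%R.
Proof.
split=> [/is_hermitianmxP M_herm i j|M_herm].
  by rewrite {1}M_herm expr0 scale1r !mxE.
by apply/is_hermitianmxP/matrixP => i j; rewrite expr0 scale1r !mxE.
Qed.

(** Both conditions are linear over the reals; the Hermitian one survives because real coefficients
    are fixed by conjugation. *)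
Lemma hermsymmx_toeplitz_span (n : nat) (S : set 'M[R[i]]_n) :
    (forall M, S M -> M \is hermsymmx /\ toeplitz M) ->
  forall M, real_span S M -> M \is hermsymmx /\ toeplitz M.
Proof.
move=> hS _ [k [A [c [SA ->]]]]; split; last first.
  move=> i i' j j' ij; rewrite !summxE; apply: eq_bigr => t _.
  by have [_ TA] := hS _ (SA t); rewrite !mxE (TA i i' j j').
apply/hermsymmx_entry => i j; rewrite !summxE rmorph_sum.
apply: eq_bigr => t _; have [/hermsymmx_entry HA _] := hS _ (SA t).
rewrite !mxE HA rmorphM; congr (_ * _); exact/esym/conjc_real.
Qed.

Lemma compress_sum (m n : nat) (Phi : 'M[R[i]]_(m, n)) (k : nat)
    (c : 'I_k -> R[i]) (A : 'I_k -> 'M[R[i]]_n) :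
  compress Phi (\sum_(t < k) c t *: A t) =
  \sum_(t < k) c t *: compress Phi (A t).
Proof.
rewrite /compress mulmx_sumr mulmx_suml; apply: eq_bigr => t _.
by rewrite -scalemxAr -scalemxAl.
Qed.

(** By linearity of compression. This makes the surjectivity of a covariance sampler automatic, so
    that only injectivity is at stake. *)
Lemma compress_real_span (m n : nat) (Phi : 'M[R[i]]_(m, n))
    (S : set 'M[R[i]]_n) :
  compress Phi @` real_span S = real_span (compress Phi @` S).
Proof.
apply/seteqP; split=> [_ [_ [k [A [c [SA ->]]]] <-]|_ [k [B [c [SB ->]]]]].
  exists k, (fun t => compress Phi (A t)), c; split; last exact: compress_sum.
  by move=> t; exists (A t).
(* Choose for every [B t] a preimage in [S]. *)
have [A AP] := choice (fun t => let: ex_intro2 M SM E := SB t in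
  ex_intro (fun M => S M /\ compress Phi M = B t) M (conj SM E)).
exists (\sum_(t < k) (c t)%:C *: A t).
  by exists k, A, c; split=> // t; case: (AP t).
by rewrite compress_sum; apply: eq_bigr => t _; case: (AP t) => _ ->.
Qed.

Lemma compress_sparse_sampler (L : nat) (K : {set 'I_L}) (M : 'M[R[i]]_L)
    (s t : 'I_#|K|) :
  compress (sparse_sampler R K) M s t = M (enum_val s) (enum_val t).
Proof.
rewrite /compress /sparse_sampler mul_rowsub_mx mul1mx.
rewrite !mxE (bigD1 (enum_val t)) //= big1 => [|j /negPf jt].
  by rewrite !mxE eqxx conjC1 mulr1 addr0.
by rewrite !mxE eq_sym jt conjC0 mulr0.
Qed.

End Span.

(** The disjunction expresses $|i - j| = d$ without truncated subtraction, and keeps the entries at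
    0 or 1 when [d] is 0, where both tests coincide. *)
Definition lag_mx (R : realType) (L d : nat) : 'M[R[i]]_L :=
  \matrix_(i, j) ((j == i + d :> nat) || (i == j + d :> nat))%N%:R.

Lemma lag_mx_hermsymmx_toeplitz (R : realType) (L d : nat) :
  lag_mx R L d \is hermsymmx /\ toeplitz (lag_mx R L d).
Proof.
split; first by apply/hermsymmx_entry => i j; rewrite !mxE conjC_nat orbC.
move=> i i' j j' ij; rewrite !mxE.
by congr ((_ || _)%:R); apply/eqP/eqP; lia.
Qed.

Lemma lag_mx_neq0 (R : realType) (L d : nat) : (d < L)%N -> lag_mx R L d != 0.
Proof.
move=> dL; have L0 : (0 < L)%N by lia.
(* The entry in row 0 and column [d] is 1. *)
apply/eqP => /matrixP/(_ (Ordinal L0) (Ordinal dL))/eqP.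
by rewrite !mxE /= add0n eqxx oner_eq0.
Qed.

Theorem theorem3 (R : realType) (L : nat) (hL : (1 <= L)%N) (K : {set 'I_L}) :
  universal_covariance_sampler (sparse_sampler R K) <->
  difference_set (int_set_of K) =
    [set d : int | (0 <= d)%R /\ (d < L%:Z)%R]%classic.
Proof.
split=> [univ|KE S hS _].
  apply/seteqP; split; first exact: difference_set_int_set_of_sub.
  move=> d /= [d0 dL]; case: d d0 dL => // d _ dL; apply: contrapT => /difference_set_int_set_of Kd.
  have D0 : lag_mx R L d != 0 by apply: lag_mx_neq0; lia.
  (* Test universality on a singleton: its span contains both 0 and [lag_mx R L d], which
     injectivity must separate. *)
  have [|_ inj _] := univ [set lag_mx R L d] _ (real_lin_indep1 D0).
    by move=> _ ->; exact: lag_mx_hermsymmx_toeplitz.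
  case/eqP: D0; apply: inj.
  - by rewrite inE; exact: sub_real_span.
  - by rewrite inE; exact: real_span0.
  apply/matrixP => s t; rewrite !compress_sparse_sampler !mxE.
  (* A nonzero entry of the compression would exhibit two elements of [K] at distance [d]. *)
  have [/orP[/eqP E|/eqP E]|//] := boolP (_ || _); case: Kd.
  - by exists (enum_val s), (enum_val t); split=> //; exact: enum_valP.
  - by exists (enum_val t), (enum_val s); split=> //; exact: enum_valP.
rewrite /covariance_sampler -compress_real_span.
split; [by move=> M SM; exists M | | by move=> _ [M SM <-]; exists M].
move=> M N; rewrite !inE => /(hermsymmx_toeplitz_span hS)[/hermsymmx_entry HM TM].
move=> /(hermsymmx_toeplitz_span hS)[/hermsymmx_entry HN TN] MN.
(* On and below the diagonal, [i - j] is a genuine lag, realised as [b - a] with [a] and [b] in [K].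
   The Toeplitz property moves position [(i, j)] to [(b, a)], an entry that compression retains. *)
have low (i j : 'I_L) : (j <= i)%N -> M i j = N i j.
  move=> ji; have /difference_set_int_set_of[a [b [aK bK abE]]] :
      difference_set (int_set_of K) (i - j)%N%:Z.
    by rewrite KE /=; have := ltn_ord i; lia.
  have ab : (i + a = b + j)%N by lia.
  rewrite (TM i b j a ab) (TN i b j a ab).
  rewrite -(enum_rankK_in aK aK) -(enum_rankK_in bK bK).
  by rewrite -!compress_sparse_sampler MN.
(* Above the diagonal, Hermitian symmetry reduces to the transposed entry. *)
apply/matrixP => i j; have [/low//|/ltnW ij] := leqP j i.
by rewrite HM HN low.
Qed.
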